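(* Let $\tau\in(0,1)$ and let $c$ be a constant. For the sequences $(\mathbf{x}^k)$ and $(\boldsymbol{\lambda}^k)$ generated by the proximal ADMM described in the context, the Lyapunov function values $T_c^{k+1}$ are bounded below: there is a real constant $M$ (independent of $k$) such that $T_c^{k+1}\ge M>-\infty$ for all $k\ge 1$.
   Context: Problem: minimize $F(\mathbf{x})=g(\mathbf{x})+\sum_{i=1}^N f_i(\mathbf{x}_i)$ over $\mathbf{x}=(\mathbf{x}_i)_{i=1}^N\in\mathbb{R}^n$, $\mathbf{x}_i\in\mathbb{R}^{n_i}$, $n=\sum_i n_i$, subject to $\sum_{i=1}^N\mathbf{A}_i\mathbf{x}_i=\mathbf{b}$ and $\mathbf{x}_i\in\mathbf{X}_i$, $i=1,\dots,N$. Here $f_i:\mathbb{R}^{n_i}\to\mathbb{R}$ and $g:\mathbb{R}^n\to\mathbb{R}$ are continuously differentiable, possibly nonconvex; $\mathbf{A}_i\in\mathbb{R}^{m\times n_i}$, $\mathbf{A}=(\mathbf{A}_1,\dots,\mathbf{A}_N)\in\mathbb{R}^{m\times n}$, $\mathbf{b}\in\mathbb{R}^m$; each $\mathbf{X}_i\subseteq\mathbb{R}^{n_i}$ is a compact convex set. Write $f(\mathbf{x})=\sum_i f_i(\mathbf{x}_i)$ and $\mathbf{X}=\mathbf{X}_1\times\cdots\times\mathbf{X}_N$. Standing assumptions: (A1) $\nabla f$ and $\nabla g$ are Lipschitz continuous on $\mathbf{X}$ with moduli $L_f$ and $L_g$; (A2) $f$ and $g$ are bounded below on $\mathbf{X}$.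 Proximal ADMM: parameters are a discount factor $\tau$, a penalty parameter $\rho>0$, a proximal parameter $\beta$, and real matrices $\mathbf{B}_i$ with $n_i$ columns. Starting from initial $\mathbf{x}^0\in\mathbb{R}^n$, $\boldsymbol{\lambda}^0\in\mathbb{R}^m$, for $k=0,1,2,\dots$ compute, for each $i$ in parallel, $$\mathbf{x}_i^{k+1}\in\arg\min_{\mathbf{x}_i\in\mathbf{X}_i}\Big\{\langle\nabla_i g(\mathbf{x}^k),\mathbf{x}_i-\mathbf{x}_i^k\rangle+f_i(\mathbf{x}_i)+\langle\boldsymbol{\lambda}^k,\mathbf{A}_i\mathbf{x}_i\rangle+\tfrac{\rho}{2}\big\|\mathbf{A}_i\mathbf{x}_i+\sum_{j\ne i}\mathbf{A}_j\mathbf{x}_j^k-\mathbf{b}\big\|^2+\tfrac{\beta}{2}\|\mathbf{B}_i(\mathbf{x}_i-\mathbf{x}_i^k)\|^2\Big\},$$ where $\nabla_i g$ is the partial gradient with respect to $\mathbf{x}_i$, and then $$\boldsymbol{\lambda}^{k+1}=(1-\tau)\boldsymbol{\lambda}^k+\rho(\mathbf{A}\mathbf{x}^{k+1}-\mathbf{b}).$$ Notation: $G_{\mathbf{A}}=\mathrm{diag}(\mathbf{A}_1^\top\mathbf{A}_1,\dots,\mathbf{A}_N^\top\mathbf{A}_N)$, $G_{\mathbf{B}}=\mathrm{diag}(\mathbf{B}_1^\top\mathbf{B}_1,\dots,\mathbf{B}_N^\top\mathbf{B}_N)$ (block diagonal), $\mathbf{Q}=\rho G_{\mathbf{A}}+\beta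 G_{\mathbf{B}}-\rho\mathbf{A}^\top\mathbf{A}$, $\|\mathbf{v}\|^2_{\mathbf{Q}}:=\mathbf{v}^\top\mathbf{Q}\mathbf{v}$; $\|\cdot\|$ is the Euclidean norm. Augmented Lagrangian: $\mathbb{L}_\rho(\mathbf{x},\boldsymbol{\lambda})=F(\mathbf{x})+\langle\boldsymbol{\lambda},\mathbf{A}\mathbf{x}-\mathbf{b}\rangle+\frac{\rho}{2}\|\mathbf{A}\mathbf{x}-\mathbf{b}\|^2$; regularized version $\mathbb{L}^+_\rho(\mathbf{x},\boldsymbol{\lambda})=\mathbb{L}_\rho(\mathbf{x},\boldsymbol{\lambda})-\frac{\tau}{2\rho}\|\boldsymbol{\lambda}\|^2$. Lyapunov function: for $k\ge 0$, $$T_c^{k+1}=\mathbb{L}^+_\rho(\mathbf{x}^{k+1},\boldsymbol{\lambda}^{k+1})+c\Big(\frac{1-2\tau^2}{2\rho}\|\boldsymbol{\lambda}^{k+1}-\boldsymbol{\lambda}^k\|^2+\frac12\|\mathbf{x}^{k+1}-\mathbf{x}^k\|^2_{\mathbf{Q}}+\frac{L_g}{2}\|\mathbf{x}^{k+1}-\mathbf{x}^k\|^2\Big).$$ *)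

(* Defs.v *)
From HB Require Import structures.
From mathcomp Require Import all_boot all_order all_algebra.
From mathcomp Require Import boolp classical_sets functions reals topology.
From mathcomp Require Import normedtype derive convex.

Set Implicit Arguments.
Unset Strict Implicit.
Unset Printing Implicit Defensive.

Import Order.TTheory GRing.Theory Num.Theory.
Import numFieldNormedType.Exports.

Local Open Scope classical_set_scope.
Local Open Scope ring_scope.

Definition dot (R : realType) (d : nat) (u v : 'cV[R]_d) : R :=
  (u^T *m v) 0 0.

(* The norm `|v| of the library on matrices is the sup norm; the Euclidean norm
   has to be introduced separately (both induce the same topology). *)
Definition enorm (R : realType) (d : nat) (v : 'cV[R]_d) : R :=
  Num.sqrt (dot v v).

Definition sqnorm_mx (R : realType) (d : nat) (Q : 'M[R]_d) (v : 'cV[R]_d) : R :=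
  (v^T *m Q *m v) 0 0.

Definition grad (R : realType) (d : nat) (h : 'cV[R]_d -> R) (x : 'cV[R]_d) :
    'cV[R]_d :=
  \col_j 'D_(delta_mx j 0) h x.

Definition C1 (R : realType) (d : nat) (h : 'cV[R]_d -> R) : Prop :=
  (forall x, differentiable h x) /\ continuous (grad h).

Definition lipschitz_modulus (R : realType) (d e : nat) (D : set 'cV[R]_d)
    (L : R) (h : 'cV[R]_d -> 'cV[R]_e) : Prop :=
  0 <= L /\ forall x y, D x -> D y -> enorm (h x - h y) <= L * enorm (x - y).

Definition is_argmin (R : realType) (T : Type) (D : set T) (h : T -> R) (x : T) :
    Prop :=
  D x /\ forall y, D y -> h x <= h y.

(* Throughout, R^n with n = n_1 + ... + n_N is 'cV[R]_(\sum_i n_ i), and the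
   i-th block x_i of x is submxcol x i. *)

Definition block_sum (R : realType) (N : nat) (n_ : 'I_N -> nat)
    (f : forall i, 'cV[R]_(n_ i) -> R) (x : 'cV[R]_(\sum_i n_ i)) : R :=
  \sum_i f i (submxcol x i).

Definition block_prod (R : realType) (N : nat) (n_ : 'I_N -> nat)
    (X : forall i, set 'cV[R]_(n_ i)) : set 'cV[R]_(\sum_i n_ i) :=
  [set x | forall i, X i (submxcol x i)].

Definition objective (R : realType) (N : nat) (n_ : 'I_N -> nat)
    (f : forall i, 'cV[R]_(n_ i) -> R) (g : 'cV[R]_(\sum_i n_ i) -> R)
    (x : 'cV[R]_(\sum_i n_ i)) : R :=
  g x + block_sum f x.

Definition block_gram (R : realType) (N : nat) (n_ p_ : 'I_N -> nat)
    (B : forall i, 'M[R]_(p_ i, n_ i)) : 'M[R]_(\sum_i n_ i) :=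
  \mxdiag_i ((B i)^T *m B i).

Definition Qmx (R : realType) (N m : nat) (n_ p_ : 'I_N -> nat)
    (A : forall i, 'M[R]_(m, n_ i)) (B : forall i, 'M[R]_(p_ i, n_ i))
    (rho beta : R) : 'M[R]_(\sum_i n_ i) :=
  rho *: block_gram A + beta *: block_gram B
    - rho *: ((\mxrow_i A i)^T *m \mxrow_i A i).

Definition admm_block_objective (R : realType) (N m : nat) (n_ p_ : 'I_N -> nat)
    (f : forall i, 'cV[R]_(n_ i) -> R) (g : 'cV[R]_(\sum_i n_ i) -> R)
    (A : forall i, 'M[R]_(m, n_ i)) (b : 'cV[R]_m)
    (B : forall i, 'M[R]_(p_ i, n_ i)) (rho beta : R)
    (xk : 'cV[R]_(\sum_i n_ i)) (lamk : 'cV[R]_m) (i : 'I_N)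
    (y : 'cV[R]_(n_ i)) : R :=
  dot (submxcol (grad g xk) i) (y - submxcol xk i)
  + f i y
  + dot lamk (A i *m y)
  + rho / 2 * enorm (A i *m y + \sum_(j | j != i) A j *m submxcol xk j - b) ^+ 2
  + beta / 2 * enorm (B i *m (y - submxcol xk i)) ^+ 2.

(* The initial point (x 0, lam 0) is arbitrary; in particular x 0 need not lie
   in the constraint set. *)
Definition proximal_admm (R : realType) (N m : nat) (n_ p_ : 'I_N -> nat)
    (f : forall i, 'cV[R]_(n_ i) -> R) (g : 'cV[R]_(\sum_i n_ i) -> R)
    (A : forall i, 'M[R]_(m, n_ i)) (b : 'cV[R]_m)
    (X : forall i, set 'cV[R]_(n_ i))
    (B : forall i, 'M[R]_(p_ i, n_ i)) (tau rho beta : R)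
    (x : nat -> 'cV[R]_(\sum_i n_ i)) (lam : nat -> 'cV[R]_m) : Prop :=
  forall k,
    (forall i, is_argmin (X i)
       (admm_block_objective f g A b B rho beta (x k) (lam k) (i := i))
       (submxcol (x k.+1) i)) /\
    lam k.+1 = (1 - tau) *: lam k + rho *: (\mxrow_i A i *m x k.+1 - b).

Definition aug_lagrangian (R : realType) (N m : nat) (n_ : 'I_N -> nat)
    (f : forall i, 'cV[R]_(n_ i) -> R) (g : 'cV[R]_(\sum_i n_ i) -> R)
    (A : forall i, 'M[R]_(m, n_ i)) (b : 'cV[R]_m) (rho : R)
    (x : 'cV[R]_(\sum_i n_ i)) (lam : 'cV[R]_m) : R :=
  objective f g x + dot lam (\mxrow_i A i *m x - b)
  + rho / 2 * enorm (\mxrow_i A i *m x - b) ^+ 2.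

Definition reg_aug_lagrangian (R : realType) (N m : nat) (n_ : 'I_N -> nat)
    (f : forall i, 'cV[R]_(n_ i) -> R) (g : 'cV[R]_(\sum_i n_ i) -> R)
    (A : forall i, 'M[R]_(m, n_ i)) (b : 'cV[R]_m) (tau rho : R)
    (x : 'cV[R]_(\sum_i n_ i)) (lam : 'cV[R]_m) : R :=
  aug_lagrangian f g A b rho x lam - tau / (2 * rho) * enorm lam ^+ 2.

(* lyapunov ... k is T_c^{k+1}: it involves the iterates k and k + 1. *)
Definition lyapunov (R : realType) (N m : nat) (n_ p_ : 'I_N -> nat)
    (f : forall i, 'cV[R]_(n_ i) -> R) (g : 'cV[R]_(\sum_i n_ i) -> R)
    (A : forall i, 'M[R]_(m, n_ i)) (b : 'cV[R]_m)
    (B : forall i, 'M[R]_(p_ i, n_ i)) (tau rho beta Lg c : R)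
    (x : nat -> 'cV[R]_(\sum_i n_ i)) (lam : nat -> 'cV[R]_m) (k : nat) : R :=
  reg_aug_lagrangian f g A b tau rho (x k.+1) (lam k.+1)
  + c * ((1 - 2 * tau ^+ 2) / (2 * rho) * enorm (lam k.+1 - lam k) ^+ 2
         + 1 / 2 * sqnorm_mx (Qmx A B rho beta) (x k.+1 - x k)
         + Lg / 2 * enorm (x k.+1 - x k) ^+ 2).

(* Main.v *)
(* Every iterate after the initial point lies in the compact set X, so the
   residuals A x^k - b are bounded; since |1 - tau| < 1, the recursion for the
   multipliers then keeps them bounded too. All terms of the Lyapunov function
   other than F are continuous in bounded quantities, and F is bounded below
   on X. *)

Require Import Defs.
From HB Require Import structures.
From mathcomp Require Import all_boot all_order all_algebra.
From mathcomp Require Import boolp classical_sets functions reals topology.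
From mathcomp Require Import normedtype derive convex.

Set Implicit Arguments.
Unset Strict Implicit.
Unset Printing Implicit Defensive.

Import Order.TTheory GRing.Theory Num.Theory.
Import numFieldNormedType.Exports.

Local Open Scope classical_set_scope.
Local Open Scope ring_scope.

Definition bounded_seq (R : realType) (u : nat -> R) : Prop :=
  exists C, forall k, `|u k| <= C.

Lemma bounded_seq_cst (R : realType) (a : R) : bounded_seq (fun=> a).
Proof. by exists `|a|. Qed.

Lemma bounded_seqD (R : realType) (u v : nat -> R) :
  bounded_seq u -> bounded_seq v -> bounded_seq (fun k => u k + v k).
Proof.
move=> [C uC] [D vD]; exists (C + D) => k.
by rewrite (le_trans (ler_normD _ _))// lerD.
Qed.

Lemma bounded_seqM (R : realType) (u v : nat -> R) :
  bounded_seq u -> bounded_seq v -> bounded_seq (fun k => u k * v k).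
Proof. by move=> [C uC] [D vD]; exists (C * D) => k; rewrite normrM ler_pM. Qed.

Lemma bounded_seqN (R : realType) (u : nat -> R) :
  bounded_seq u -> bounded_seq (fun k => - u k).
Proof. by move=> [C uC]; exists C => k; rewrite normrN. Qed.

Lemma bounded_seq_sum (R : realType) (I : finType) (u : I -> nat -> R) :
  (forall i, bounded_seq (u i)) -> bounded_seq (fun k => \sum_i u i k).
Proof.
move=> /fin_all_exists[C uC]; exists (\sum_i C i) => k.
by rewrite (le_trans (ler_norm_sum _ _ _))// ler_sum.
Qed.

(** The interval from [- D] to [D] is invariant as soon as [a * D + C <= D], that is
    [C / (1 - a) <= D]; taking [D] at least [|u 0|] as well starts the induction. *)
Lemma bounded_seq_recurrence (R : realType) (a : R) (u v : nat -> R) :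
  0 <= a < 1 -> bounded_seq v -> (forall k, u k.+1 = a * u k + v k) ->
  bounded_seq u.
Proof.
move=> /andP[a_ge0 a_lt1] [C vC] uS; exists (Num.max `|u 0| (C / (1 - a))).
elim=> [|k IHk]; first by rewrite le_max lexx.
have a1 : 0 < 1 - a by rewrite subr_gt0.
set D := Num.max _ _ in IHk *.
have CD : C <= (1 - a) * D by rewrite mulrC -ler_pdivrMr// le_max lexx orbT.
rewrite uS (le_trans (ler_normD _ _))// normrM (ger0_norm a_ge0).
apply: (@le_trans _ _ (a * D + (1 - a) * D)); last by rewrite -mulrDl addrC subrK mul1r.
by rewrite lerD ?ler_wpM2l ?(le_trans (vC k)).
Qed.

(** Boundedness is entrywise, so that products, transposes and quadratic forms reduce to finite sums
    and products of scalar sequences, with no comparison of norms. *)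
Definition bounded_mxseq (R : realType) (p q : nat) (u : nat -> 'M[R]_(p, q)) :
    Prop :=
  forall i j, bounded_seq (fun k => u k i j).

Lemma bounded_mxseq_cst (R : realType) (p q : nat) (M : 'M[R]_(p, q)) :
  bounded_mxseq (fun=> M).
Proof. by move=> i j; exact: bounded_seq_cst. Qed.

Lemma bounded_mxseqB (R : realType) (p q : nat) (u v : nat -> 'M[R]_(p, q)) :
  bounded_mxseq u -> bounded_mxseq v -> bounded_mxseq (fun k => u k - v k).
Proof.
move=> bu bv i j; have [C uvC] := bounded_seqD (bu i j) (bounded_seqN (bv i j)).
by exists C => k; rewrite !mxE.
Qed.

Lemma bounded_mxseq_tr (R : realType) (p q : nat) (u : nat -> 'M[R]_(p, q)) :
  bounded_mxseq u -> bounded_mxseq (fun k => (u k)^T).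
Proof. by move=> bu i j; have [C uC] := bu j i; exists C => k; rewrite mxE. Qed.

Lemma bounded_mxseqM (R : realType) (p q r : nat)
    (u : nat -> 'M[R]_(p, q)) (v : nat -> 'M[R]_(q, r)) :
  bounded_mxseq u -> bounded_mxseq v -> bounded_mxseq (fun k => u k *m v k).
Proof.
move=> bu bv i j.
have [C uvC] := bounded_seq_sum (fun l => bounded_seqM (bu i l) (bv l j)).
by exists C => k; rewrite mxE.
Qed.

Lemma bounded_dot (R : realType) (d : nat) (u v : nat -> 'cV[R]_d) :
  bounded_mxseq u -> bounded_mxseq v -> bounded_seq (fun k => dot (u k) (v k)).
Proof. by move=> bu bv; exact: (bounded_mxseqM (bounded_mxseq_tr bu) bv). Qed.

Lemma sqr_enorm (R : realType) (d : nat) (v : 'cV[R]_d) :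
  enorm v ^+ 2 = dot v v.
Proof.
rewrite /enorm sqr_sqrtr// /dot mxE sumr_ge0// => i _.
by rewrite mxE -expr2 sqr_ge0.
Qed.

Lemma bounded_sqr_enorm (R : realType) (d : nat) (u : nat -> 'cV[R]_d) :
  bounded_mxseq u -> bounded_seq (fun k => enorm (u k) ^+ 2).
Proof.
move=> bu; have [C uC] := bounded_dot bu bu.
by exists C => k; rewrite sqr_enorm.
Qed.

Lemma bounded_sqnorm_mx (R : realType) (d : nat) (Q : 'M[R]_d)
    (u : nat -> 'cV[R]_d) :
  bounded_mxseq u -> bounded_seq (fun k => sqnorm_mx Q (u k)).
Proof.
move=> bu; apply: (bounded_mxseqM _ bu).
exact: bounded_mxseqM (bounded_mxseq_tr bu) (bounded_mxseq_cst Q).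
Qed.

(** Each coordinate map is continuous, so it sends [K] to a compact, hence bounded, set of reals. *)
Lemma compact_bounded_mxseq (R : realType) (p q : nat) (K : set 'M[R]_(p, q))
    (u : nat -> 'M[R]_(p, q)) :
  compact K -> (forall k, K (u k)) -> bounded_mxseq u.
Proof.
move=> cK uK i j.
have /compact_bounded[C [_ boundC]] :
    compact [set (M i j : R^o) | M in K].
  apply: continuous_compact cK; apply: continuous_subspaceT.
  exact: coord_continuous.
(* Boundedness of a set provides a bound for every number strictly above [C]; [C + 1] is one such
   number. *)
exists (C + 1) => k; apply: (boundC (C + 1)); first by rewrite ltrDl.
by exists (u k).
Qed.

(** Row [s] of a stacked vector is row [tagnat.sig2 s] of its block [tagnat.sig1 s], and that block
    stays in a compact set. *)
Lemma compact_bounded_block_prod (R : realType) (N : nat) (n_ : 'I_N -> nat)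
    (X : forall i, set 'cV[R]_(n_ i)) (u : nat -> 'cV[R]_(\sum_i n_ i)) :
  (forall i, compact (X i)) -> (forall k, block_prod X (u k)) ->
  bounded_mxseq u.
Proof.
move=> cX uX s j.
have [C uC] := compact_bounded_mxseq (cX (tagnat.sig1 s)) (uX^~ (tagnat.sig1 s)) (tagnat.sig2 s) j.
by exists C => k; rewrite -[u k]submxcolK mxE.
Qed.

Theorem proposition5 (R : realType) (N m : nat) (n_ p_ : 'I_N -> nat)
    (f : forall i : 'I_N, 'cV[R]_(n_ i) -> R)
    (g : 'cV[R]_(\sum_i n_ i) -> R)
    (A : forall i : 'I_N, 'M[R]_(m, n_ i)) (b : 'cV[R]_m)
    (X : forall i : 'I_N, set 'cV[R]_(n_ i))
    (B : forall i : 'I_N, 'M[R]_(p_ i, n_ i))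
    (tau rho beta Lf Lg c : R)
    (x : nat -> 'cV[R]_(\sum_i n_ i)) (lam : nat -> 'cV[R]_m)
    (f_C1 : forall i, C1 (f i)) (g_C1 : C1 g)
    (X_compact : forall i, compact (X i))
    (X_convex : forall i, convex_set (X i))
    (grad_f_lip : lipschitz_modulus (block_prod X) Lf (grad (block_sum f)))
    (grad_g_lip : lipschitz_modulus (block_prod X) Lg (grad g))
    (f_lb : has_lbound [set block_sum f y | y in block_prod X])
    (g_lb : has_lbound [set g y | y in block_prod X])
    (tau_gt0 : 0 < tau) (tau_lt1 : tau < 1) (rho_gt0 : 0 < rho)
    (xlam_admm : proximal_admm f g A b X B tau rho beta x lam) :
  exists M : R, forall k : nat, (1 <= k)%N ->
    M <= lyapunov f g A b B tau rho beta Lg c x lam k.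
Proof.
have xX k : block_prod X (x k.+1) by move=> i; have [/(_ i)[]] := xlam_admm k.
(* The sequence starts at [x 1], since [x 0] is arbitrary and may lie outside the constraint set. *)
have bx : bounded_mxseq (fun k => x k.+1) by exact: compact_bounded_block_prod xX.
have br : bounded_mxseq (fun k => \mxrow_i A i *m x k.+1 - b).
  apply: bounded_mxseqB (bounded_mxseq_cst b).
  exact: bounded_mxseqM (bounded_mxseq_cst _) bx.
(* The multiplier update, read entry by entry, is a scalar recursion with factor [1 - tau] and the
   bounded perturbation [rho] times the residual. *)
have blam : bounded_mxseq lam.
  move=> i j; apply: (@bounded_seq_recurrence _ (1 - tau) _
    (fun k => rho * (\mxrow_i A i *m x k.+1 - b) i j)).
  - by rewrite subr_ge0 ltW//= ltrBlDr ltrDl.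
  - exact: bounded_seqM (bounded_seq_cst rho) (br i j).
  - by move=> k; rewrite (xlam_admm k).2 !mxE.
have shift p q (u : nat -> 'M[R]_(p, q)) :
    bounded_mxseq u -> bounded_mxseq (fun k => u k.+1).
  by move=> bu i j; have [C uC] := bu i j; exists C => k.
(* From here on everything is indexed as in [lyapunov] at [k.+1], which involves the iterates [k.+2]
   and [k.+1]; both primal ones are then feasible. *)
have bdx := bounded_mxseqB (shift _ _ _ bx) bx.
have bdlam := shift _ _ _ (bounded_mxseqB (shift _ _ _ blam) blam).
have blam2 := shift _ _ _ (shift _ _ _ blam).
have br2 := shift _ _ _ br.
have cstM (a : R) u : bounded_seq u -> bounded_seq (fun k => a * u k).
  by move=> bu; exact: bounded_seqM (bounded_seq_cst a) bu.
(* [C] bounds in absolute value all of [lyapunov] at [k.+1] except the objective; the sums are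
   nested as in its definition. The sign of [c] is irrelevant, as is definiteness of [Qmx]. *)
have [C boundC] := bounded_seqD (bounded_seqD (bounded_seqD
  (bounded_dot blam2 br2)
  (cstM (rho / 2) _ (bounded_sqr_enorm br2)))
  (bounded_seqN (cstM (tau / (2 * rho)) _ (bounded_sqr_enorm blam2))))
  (cstM c _ (bounded_seqD (bounded_seqD
    (cstM ((1 - 2 * tau ^+ 2) / (2 * rho)) _ (bounded_sqr_enorm bdlam))
    (cstM (1 / 2) _ (bounded_sqnorm_mx (Qmx A B rho beta) bdx)))
    (cstM (Lg / 2) _ (bounded_sqr_enorm bdx)))).
have [mf f_ge] := f_lb; have [mg g_ge] := g_lb.
(* The hypothesis [1 <= k] discards [k = 0], whose value involves [x 0]; the index becomes
   [k.+1]. *)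
exists (mg + mf - C) => -[//|k] _.
have := boundC k; rewrite ler_norml => /andP[+ _] => restC.
have gx : mg <= g (x k.+2) by apply: g_ge; exists (x k.+2).
have fx : mf <= block_sum f (x k.+2) by apply: f_ge; exists (x k.+2).
rewrite (le_trans (lerD (lerD gx fx) restC))//.
by rewrite /lyapunov /reg_aug_lagrangian /aug_lagrangian /objective !addrA.
Qed.
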